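(* Let $\mathcal{A}$ be an additive category and let $K^b(\mathcal{A})$ denote the homotopy category of bounded complexes in $\mathcal{A}$. Then the split Grothendieck group $\operatorname{K}_{\oplus}(\mathcal{A})$ of $\mathcal{A}$ is isomorphic, as an abelian group, to the triangulated Grothendieck group $\operatorname{K}_{\triangle}(K^b(\mathcal{A}))$ of $K^b(\mathcal{A})$.
   Context: An additive category is a category with a zero object and finite biproducts in which every $\operatorname{Hom}_{\mathcal{A}}(A_1,A_2)$ is an abelian group and composition distributes over addition. The split Grothendieck group $\operatorname{K}_{\oplus}(\mathcal{A})$ of an additive category $\mathcal{A}$ is the abelian group generated by isomorphism classes $\langle A\rangle$ of objects of $\mathcal{A}$ modulo the relations $\langle A_1\oplus A_2\rangle=\langle A_1\rangle+\langle A_2\rangle$ for all objects $A_1,A_2$ of $\mathcal{A}$. The triangulated Grothendieck group $\operatorname{K}_{\triangle}(\mathcal{C})$ of a triangulated category $\mathcal{C}$ is the abelian group generated by isomorphism classes $\langle C\rangle$ of objects of $\mathcal{C}$ modulo the relations $\langle C_2\rangle=\langle C_1\rangle+\langle C_3\rangle$ for all distinguished triangles $C_1\to C_2\to C_3$ in $\mathcal{C}$. Complexes are cohomologically graded: $A^{\cdot}$ has differentials $d^i:A^i\to A^{i+1}$ with $d^{i+1}d^i=0$, and is bounded if $A^i=0$ for all but finitely many $i\in\mathbb{Z}$. The objects of $K^b(\mathcal{A})$ are bounded complexes and its morphisms are chain maps modulo chain homotopy, so isomorphism in $K^b(\mathcal{A})$ is homotopy equivalence. $K^b(\mathcal{A})$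 carries its standard triangulated structure: the distinguished triangles are those isomorphic to triangles of the form $A_1^{\cdot}\xrightarrow{f}A_2^{\cdot}\to\operatorname{cone}(f)^{\cdot}$ for a chain map $f$, where $\operatorname{cone}(f)^j=A_1^{j+1}\oplus A_2^j$ with differential $\begin{pmatrix}-d_1^{j+1}&0\\-f^{j+1}&d_2^j\end{pmatrix}$. *)

(* Defs.v *)
From HB Require Import structures.
From mathcomp Require Import all_boot all_order all_algebra.
From mathcomp Require Import generic_quotient ring_quotient.
From mathcomp Require Import boolp.
From mathcomp Require Import freeg.

Set Implicit Arguments.
Unset Strict Implicit.
Unset Printing Implicit Defensive.

Import GRing.Theory.
Local Open Scope ring_scope.
Local Open Scope quotient_scope.

Declare Scope cat_scope.
Delimit Scope cat_scope with cat.
Local Open Scope cat_scope.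

(* Classically every abelian group carries a [zmodType] structure, so asking
   for [zmodType] hom-groups is no restriction.  The zero object and the binary
   biproducts are chosen, which is harmless up to isomorphism. *)
Record addCat := AddCat {
  Ob :> Type;
  Hom : Ob -> Ob -> zmodType;
  idm : forall A, Hom A A;
  comp : forall A B C, Hom B C -> Hom A B -> Hom A C;
  compA : forall A B C D (h : Hom C D) (g : Hom B C) (f : Hom A B),
    comp h (comp g f) = comp (comp h g) f;
  comp1m : forall A B (f : Hom A B), comp (idm B) f = f;
  compm1 : forall A B (f : Hom A B), comp f (idm A) = f;
  compDl : forall A B C (g g' : Hom B C) (f : Hom A B),
    comp (g + g') f = comp g f + comp g' f;
  compDr : forall A B C (g : Hom B C) (f f' : Hom A B),
    comp g (f + f') = comp g f + comp g f';
  zob : Ob;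
  zob_initial : forall A (f : Hom zob A), f = 0;
  zob_terminal : forall A (f : Hom A zob), f = 0;
  bip : Ob -> Ob -> Ob;
  in1 : forall A B, Hom A (bip A B);
  in2 : forall A B, Hom B (bip A B);
  pr1 : forall A B, Hom (bip A B) A;
  pr2 : forall A B, Hom (bip A B) B;
  pr1_in1 : forall A B, comp (pr1 A B) (in1 A B) = idm A;
  pr2_in2 : forall A B, comp (pr2 A B) (in2 A B) = idm B;
  pr1_in2 : forall A B, comp (pr1 A B) (in2 A B) = 0;
  pr2_in1 : forall A B, comp (pr2 A B) (in1 A B) = 0;
  bip_id : forall A B,
    comp (in1 A B) (pr1 A B) + comp (in2 A B) (pr2 A B) = idm (bip A B)
}.

Arguments Hom {a} _ _.
Arguments idm {a} A.
Arguments comp {a A B C} _ _.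
Arguments zob {a}.
Arguments bip {a} A B.
Arguments in1 {a A B}.
Arguments in2 {a A B}.
Arguments pr1 {a A B}.
Arguments pr2 {a A B}.

Reserved Notation "A ~> B" (at level 90, right associativity).
Reserved Notation "g \oc f" (at level 40, left associativity).
Notation "A ~> B" := (Hom A B) : type_scope.
Notation "g \oc f" := (comp g f) : cat_scope.
Notation "A \oplus B" := (bip A B) (at level 50, left associativity) : cat_scope.

Section AddCatTheory.
Variable C : addCat.
Implicit Types X Y Z : C.

Lemma comp0m X Y Z (f : X ~> Y) : (0 : Y ~> Z) \oc f = 0.
Proof. by apply: (addrI ((0 : Y ~> Z) \oc f)); rewrite -compDl !addr0. Qed.

Lemma compm0 X Y Z (g : Y ~> Z) : g \oc (0 : X ~> Y) = 0.
Proof. by apply: (addrI (g \oc (0 : X ~> Y))); rewrite -compDr !addr0. Qed.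

Lemma compNm X Y Z (g : Y ~> Z) (f : X ~> Y) : (- g) \oc f = - (g \oc f).
Proof.
by apply: (addrI (g \oc f)); rewrite -compDl !subrr comp0m.
Qed.

Lemma compmN X Y Z (g : Y ~> Z) (f : X ~> Y) : g \oc (- f) = - (g \oc f).
Proof.
by apply: (addrI (g \oc f)); rewrite -compDr !subrr compm0.
Qed.

Definition is_zero X : Prop :=
  (forall Y (f : X ~> Y), f = 0) /\ (forall Y (f : Y ~> X), f = 0).

Definition is_iso X Y (f : X ~> Y) : Prop :=
  exists g : Y ~> X, g \oc f = idm X /\ f \oc g = idm Y.

Definition isomorphic X Y : Prop := exists f : X ~> Y, is_iso f.

Lemma isomorphic_refl X : isomorphic X X.
Proof. by exists (idm X), (idm X); rewrite comp1m. Qed.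

Lemma isomorphic_sym X Y : isomorphic X Y -> isomorphic Y X.
Proof. by move=> [f [g [gf fg]]]; exists g, f. Qed.

Lemma isomorphic_trans Y X Z :
  isomorphic X Y -> isomorphic Y Z -> isomorphic X Z.
Proof.
move=> [f [f' [f'f ff']]] [g [g' [g'g gg']]]; exists (g \oc f), (f' \oc g').
split; first by rewrite compA -(compA f') g'g compm1.
by rewrite compA -(compA g) ff' compm1.
Qed.

Lemma is_zero_bip X Y : is_zero X -> is_zero Y -> is_zero (X \oplus Y).
Proof.
move=> [X1 X2] [Y1 Y2]; have id0 : idm (X \oplus Y) = 0.
  by rewrite -bip_id (X1 _ in1) (Y1 _ in2) !comp0m addr0.
by split=> Z f; [rewrite -[f]compm1 id0 compm0 | rewrite -[f]comp1m id0 comp0m].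
Qed.

Lemma is_zero_zob : is_zero zob.
Proof. by split=> X f; [exact: zob_initial | exact: zob_terminal]. Qed.

Definition iso_rel : rel {classic C} := fun X Y => `[< isomorphic X Y >].

Lemma iso_rel_equiv : equiv_class_of iso_rel.
Proof.
split=> [X|X Y|Y X Z].
- exact/asboolP/isomorphic_refl.
- by apply/asboolP/asboolP; exact: isomorphic_sym.
- by move=> /asboolP XY /asboolP YZ; apply/asboolP/(isomorphic_trans XY).
Qed.

Canonical iso_rel_canonical := EquivRelPack iso_rel_equiv.
Canonical iso_rel_encModRel := defaultEncModRel iso_rel.

Definition iso_class : choiceType := {eq_quot iso_rel}.

Definition class_of (X : C) : iso_class := \pi_({eq_quot iso_rel}) X.

Lemma class_ofP X Y : class_of X = class_of Y <-> isomorphic X Y.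
Proof.
split=> [/eqmodP/asboolP //|XY]; exact/eqmodP/asboolP.
Qed.

End AddCatTheory.

Section Presentation.
Variables (T : choiceType) (R : {freeg T} -> Prop).

Definition relsub : {pred {freeg T}} := fun x =>
  `[< forall S : zmodClosed {freeg T}, (forall r, R r -> r \in S) -> x \in S >].

Lemma relsub_zmod_closed : zmod_closed relsub.
Proof.
split; first by apply/asboolP => S _; exact: rpred0.
move=> x y /asboolP xS /asboolP yS; apply/asboolP => S RS.
by rewrite rpredB ?xS ?yS.
Qed.

HB.instance Definition _ :=
  GRing.isZmodClosed.Build {freeg T} relsub relsub_zmod_closed.

Definition presented : zmodType := Quotient.quot relsub.

End Presentation.

Definition free_class (C : addCat) (X : C) : {freeg (iso_class C)} :=
  << class_of X >>.
Notation "<[ X ]>" := (free_class X) : cat_scope.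

Definition split_rel (C : addCat) (r : {freeg (iso_class C)}) : Prop :=
  exists X Y : C, r = <[ X \oplus Y ]> - (<[ X ]> + <[ Y ]>).

Definition K_split (C : addCat) : zmodType := presented (@split_rel C).

(* The data of a triangulated category: an additive category with a shift
   functor and a class of distinguished triangles.  The axioms TR1-TR4 are left
   out because the Grothendieck group depends on the data only. *)
Record triData := TriData {
  tri_cat :> addCat;
  shift : tri_cat -> tri_cat;
  shiftm : forall X Y : tri_cat, (X ~> Y) -> (shift X ~> shift Y);
  shiftm_id : forall X : tri_cat, shiftm (idm X) = idm (shift X);
  shiftm_comp : forall (X Y Z : tri_cat) (g : Y ~> Z) (f : X ~> Y),
    shiftm (g \oc f) = shiftm g \oc shiftm f;
  shiftmD : forall (X Y : tri_cat) (f g : X ~> Y),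
    shiftm (f + g) = shiftm f + shiftm g;
  distinguished : forall X Y Z : tri_cat,
    (X ~> Y) -> (Y ~> Z) -> (Z ~> shift X) -> Prop
}.

Definition tri_rel (C : triData) (r : {freeg (iso_class C)}) : Prop :=
  exists (X Y Z : C) (u : X ~> Y) (v : Y ~> Z) (w : Z ~> shift X),
    distinguished u v w /\ r = <[ Y ]> - (<[ X ]> + <[ Z ]>).

Definition K_tri (C : triData) : zmodType := presented (@tri_rel C).

Local Obligation Tactic := idtac.

Section Complexes.
Variable A : addCat.

Record bcomplex := BComplex {
  ob :> int -> A;
  diff : forall i, ob i ~> ob (i + 1);
  diffK : forall i, diff (i + 1) \oc diff i = 0;
  bounded : exists s : seq int, forall i, i \notin s -> is_zero (ob i)
}.

Arguments diff : clear implicits.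

Record chain_map (X Y : bcomplex) := ChainMap {
  cmap :> forall i, X i ~> Y i;
  cmapP : forall i, diff Y i \oc cmap i = cmap (i + 1) \oc diff X i
}.

Lemma chain_mapP (X Y : bcomplex) (f g : chain_map X Y) :
  (forall i, f i = g i) -> f = g.
Proof.
case: f g => [f fP] [g gP] /= fg.
have {}fg : f = g by apply: functional_extensionality_dep.
by case: _ / fg gP => gP; rewrite (Prop_irrelevance fP gP).
Qed.

HB.instance Definition _ X Y := gen_eqMixin (chain_map X Y).
HB.instance Definition _ X Y := gen_choiceMixin (chain_map X Y).

Section ChainMapZmod.
Variables X Y : bcomplex.
Implicit Types f g : chain_map X Y.

Program Definition cm0 : chain_map X Y := @ChainMap X Y (fun i => 0) _.
Next Obligation. by move=> i /=; rewrite comp0m compm0. Qed.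

Program Definition cmN f : chain_map X Y := @ChainMap X Y (fun i => - f i) _.
Next Obligation. by move=> f i /=; rewrite compNm compmN cmapP. Qed.

Program Definition cmD f g : chain_map X Y :=
  @ChainMap X Y (fun i => f i + g i) _.
Next Obligation. by move=> f g i /=; rewrite compDl compDr !cmapP. Qed.

Lemma cmDA : associative cmD.
Proof. by move=> f g h; apply: chain_mapP => i /=; rewrite addrA. Qed.
Lemma cmDC : commutative cmD.
Proof. by move=> f g; apply: chain_mapP => i /=; rewrite addrC. Qed.
Lemma cm0D : left_id cm0 cmD.
Proof. by move=> f; apply: chain_mapP => i /=; rewrite add0r. Qed.
Lemma cmND : left_inverse cm0 cmN cmD.
Proof. by move=> f; apply: chain_mapP => i /=; rewrite addNr. Qed.

HB.instance Definition _ :=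
  GRing.isZmodule.Build (chain_map X Y) cmDA cmDC cm0D cmND.

(* A homotopy has components [h i : X (i + 1) ~> Y i]; writing the homotopy
   equation in degree [i + 1] rather than [i] avoids transports along
   [i - 1 + 1 = i]. *)
Definition null_homotopic : {pred chain_map X Y} := fun f =>
  `[< exists h : forall i, X (i + 1) ~> Y i, forall i,
        f (i + 1) = diff Y i \oc h i + h (i + 1) \oc diff X (i + 1) >].

Lemma null_homotopic_zmod_closed : zmod_closed null_homotopic.
Proof.
split.
  by apply/asboolP; exists (fun=> 0) => i; rewrite compm0 comp0m addr0.
move=> f g /asboolP[h hf] /asboolP[k kg]; apply/asboolP.
exists (fun i => h i - k i) => i /=.
by rewrite hf kg compDl compDr compNm compmN opprD addrACA.
Qed.

HB.instance Definition _ :=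
  GRing.isZmodClosed.Build (chain_map X Y) null_homotopic
    null_homotopic_zmod_closed.

End ChainMapZmod.

Program Definition cm_id (X : bcomplex) : chain_map X X :=
  @ChainMap X X (fun i => idm (X i)) _.
Next Obligation. by move=> X i /=; rewrite comp1m compm1. Qed.

Program Definition cm_comp (X Y Z : bcomplex)
    (g : chain_map Y Z) (f : chain_map X Y) : chain_map X Z :=
  @ChainMap X Z (fun i => g i \oc f i) _.
Next Obligation.
by move=> X Y Z g f i /=; rewrite compA cmapP -compA cmapP compA.
Qed.

Lemma null_homotopic_compl (X Y Z : bcomplex)
    (g : chain_map Y Z) (f : chain_map X Y) :
  f \in @null_homotopic X Y -> cm_comp g f \in @null_homotopic X Z.
Proof.
move=> /asboolP[h hf]; apply/asboolP; exists (fun i => g i \oc h i) => i /=.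
by rewrite hf compDr !compA cmapP.
Qed.

Lemma null_homotopic_compr (X Y Z : bcomplex)
    (g : chain_map Y Z) (f : chain_map X Y) :
  g \in @null_homotopic Y Z -> cm_comp g f \in @null_homotopic X Z.
Proof.
move=> /asboolP[h hg]; apply/asboolP.
exists (fun i => h i \oc f (i + 1)) => i /=.
by rewrite hg compDl -!compA cmapP.
Qed.

Definition hHom (X Y : bcomplex) : zmodType :=
  Quotient.quot (@null_homotopic X Y).

Definition hclass X Y (f : chain_map X Y) : hHom X Y :=
  \pi_(Quotient.quot (@null_homotopic X Y)) f.

Lemma hclassP X Y (f g : chain_map X Y) :
  hclass f = hclass g <-> f - g \in @null_homotopic X Y.
Proof.
by rewrite Quotient.idealrBE; split=> [fg|/eqP //]; apply/eqP.
Qed.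

Lemma hclassD X Y (f g : chain_map X Y) :
  hclass (f + g) = hclass f + hclass g.
Proof. exact: raddfD. Qed.

Definition hrepr X Y (f : hHom X Y) : chain_map X Y :=
  repr (f : Quotient.quot (@null_homotopic X Y)).

Lemma hreprK X Y (f : hHom X Y) : hclass (hrepr f) = f.
Proof. exact: reprK. Qed.

Definition hcomp X Y Z (g : hHom Y Z) (f : hHom X Y) : hHom X Z :=
  hclass (cm_comp (hrepr g) (hrepr f)).

Lemma hcompE X Y Z (g : chain_map Y Z) (f : chain_map X Y) :
  hcomp (hclass g) (hclass f) = hclass (cm_comp g f).
Proof.
have /hclassP g'g := hreprK (hclass g); have /hclassP f'f := hreprK (hclass f).
rewrite /hcomp; set g' := hrepr _ in g'g *; set f' := hrepr _ in f'f *.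
apply/hclassP; have -> : cm_comp g' f' - cm_comp g f =
    cm_comp g' (f' - f) + cm_comp (g' - g) f.
  apply: chain_mapP => i /=.
  by rewrite compDl compDr compNm compmN addrA subrK.
by apply: rpredD; [exact: null_homotopic_compl | exact: null_homotopic_compr].
Qed.

Lemma hcompA X Y Z T (h : hHom Z T) (g : hHom Y Z) (f : hHom X Y) :
  hcomp h (hcomp g f) = hcomp (hcomp h g) f.
Proof.
rewrite -(hreprK h) -(hreprK g) -(hreprK f) !hcompE; congr hclass.
by apply: chain_mapP => i /=; rewrite compA.
Qed.

Lemma hcomp1m X Y (f : hHom X Y) : hcomp (hclass (cm_id Y)) f = f.
Proof.
rewrite -(hreprK f) hcompE; congr hclass.
by apply: chain_mapP => i /=; rewrite comp1m.
Qed.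

Lemma hcompm1 X Y (f : hHom X Y) : hcomp f (hclass (cm_id X)) = f.
Proof.
rewrite -(hreprK f) hcompE; congr hclass.
by apply: chain_mapP => i /=; rewrite compm1.
Qed.

Lemma hcompDl X Y Z (g g' : hHom Y Z) (f : hHom X Y) :
  hcomp (g + g') f = hcomp g f + hcomp g' f.
Proof.
rewrite -(hreprK g) -(hreprK g') -(hreprK f) -hclassD !hcompE -hclassD.
by congr hclass; apply: chain_mapP => i /=; rewrite compDl.
Qed.

Lemma hcompDr X Y Z (g : hHom Y Z) (f f' : hHom X Y) :
  hcomp g (f + f') = hcomp g f + hcomp g f'.
Proof.
rewrite -(hreprK g) -(hreprK f) -(hreprK f') -hclassD !hcompE -hclassD.
by congr hclass; apply: chain_mapP => i /=; rewrite compDr.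
Qed.

Program Definition zcomplex : bcomplex := @BComplex (fun=> zob) (fun=> 0) _ _.
Next Obligation. by move=> i /=; rewrite comp0m. Qed.
Next Obligation. by exists [::] => i _; exact: is_zero_zob. Qed.

Lemma zcomplex_initial X (f : hHom zcomplex X) : f = 0.
Proof.
rewrite -(hreprK f); have -> : hrepr f = 0.
  by apply: chain_mapP => i; exact: zob_initial.
exact: raddf0.
Qed.

Lemma zcomplex_terminal X (f : hHom X zcomplex) : f = 0.
Proof.
rewrite -(hreprK f); have -> : hrepr f = 0.
  by apply: chain_mapP => i; exact: zob_terminal.
exact: raddf0.
Qed.

Program Definition bip_complex (X Y : bcomplex) : bcomplex :=
  @BComplex (fun i => X i \oplus Y i)
    (fun i => in1 \oc diff X i \oc pr1 + in2 \oc diff Y i \oc pr2) _ _.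
Next Obligation.
move=> X Y i /=; rewrite !(compDl, compDr) !compA.
rewrite -!(compA _ pr1) -!(compA _ pr2) !(pr1_in1, pr2_in2, pr1_in2, pr2_in1).
rewrite !(compm1, compm0, comp0m) -!(compA in1) -!(compA in2) !diffK.
by rewrite !(compm0, comp0m) !addr0.
Qed.
Next Obligation.
move=> X Y; case: (bounded X) => s sP; case: (bounded Y) => t tP.
exists (s ++ t) => i; rewrite mem_cat negb_or => /andP[si ti].
by apply: is_zero_bip; [exact: sP | exact: tP].
Qed.

Section BipComplex.
Variables X Y : bcomplex.

Program Definition cm_in1 : chain_map X (bip_complex X Y) :=
  @ChainMap X (bip_complex X Y) (fun i => in1) _.
Next Obligation.
by move=> i /=; rewrite compDl -!compA pr1_in1 pr2_in1 !(compm1, compm0) addr0.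
Qed.

Program Definition cm_in2 : chain_map Y (bip_complex X Y) :=
  @ChainMap Y (bip_complex X Y) (fun i => in2) _.
Next Obligation.
by move=> i /=; rewrite compDl -!compA pr1_in2 pr2_in2 !(compm1, compm0) add0r.
Qed.

Program Definition cm_pr1 : chain_map (bip_complex X Y) X :=
  @ChainMap (bip_complex X Y) X (fun i => pr1) _.
Next Obligation.
by move=> i /=; rewrite compDr !compA pr1_in1 pr1_in2 !(comp1m, comp0m) addr0.
Qed.

Program Definition cm_pr2 : chain_map (bip_complex X Y) Y :=
  @ChainMap (bip_complex X Y) Y (fun i => pr2) _.
Next Obligation.
by move=> i /=; rewrite compDr !compA pr2_in1 pr2_in2 !(comp1m, comp0m) add0r.
Qed.

Lemma hpr1_in1 : hcomp (hclass cm_pr1) (hclass cm_in1) = hclass (cm_id X).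
Proof. by rewrite hcompE; congr hclass; apply: chain_mapP => i; exact: pr1_in1. Qed.

Lemma hpr2_in2 : hcomp (hclass cm_pr2) (hclass cm_in2) = hclass (cm_id Y).
Proof. by rewrite hcompE; congr hclass; apply: chain_mapP => i; exact: pr2_in2. Qed.

Lemma hpr1_in2 : hcomp (hclass cm_pr1) (hclass cm_in2) = 0.
Proof.
rewrite hcompE (_ : cm_comp _ _ = 0); first exact: raddf0.
by apply: chain_mapP => i; exact: pr1_in2.
Qed.

Lemma hpr2_in1 : hcomp (hclass cm_pr2) (hclass cm_in1) = 0.
Proof.
rewrite hcompE (_ : cm_comp _ _ = 0); first exact: raddf0.
by apply: chain_mapP => i; exact: pr2_in1.
Qed.

Lemma hbip_id :
  hcomp (hclass cm_in1) (hclass cm_pr1) + hcomp (hclass cm_in2) (hclass cm_pr2)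
    = hclass (cm_id (bip_complex X Y)).
Proof.
rewrite !hcompE -hclassD; congr hclass.
by apply: chain_mapP => i; exact: bip_id.
Qed.

End BipComplex.

Definition Kb_add : addCat :=
  @AddCat bcomplex hHom (fun X => hclass (cm_id X)) hcomp
    hcompA hcomp1m hcompm1 hcompDl hcompDr
    zcomplex zcomplex_initial zcomplex_terminal
    bip_complex _ _ _ _ hpr1_in1 hpr2_in2 hpr1_in2 hpr2_in1 hbip_id.

Program Definition cshift (X : bcomplex) : bcomplex :=
  @BComplex (fun i => X (i + 1)) (fun i => - diff X (i + 1)) _ _.
Next Obligation. by move=> X i /=; rewrite compNm compmN opprK diffK. Qed.
Next Obligation.
move=> X; case: (bounded X) => s sP; exists [seq i - 1 | i <- s] => i si.
by apply: sP; apply: contra si => si; apply/mapP; exists (i + 1); rewrite ?addrK.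
Qed.

Program Definition cm_shift X Y (f : chain_map X Y) :
  chain_map (cshift X) (cshift Y) :=
  @ChainMap (cshift X) (cshift Y) (fun i => f (i + 1)) _.
Next Obligation. by move=> X Y f i /=; rewrite compNm compmN cmapP. Qed.

Lemma null_homotopic_shift X Y (f : chain_map X Y) :
  f \in @null_homotopic X Y ->
  cm_shift f \in @null_homotopic (cshift X) (cshift Y).
Proof.
move=> /asboolP[h hf]; apply/asboolP; exists (fun i => - h (i + 1)) => i /=.
by rewrite hf !compNm !compmN !opprK.
Qed.

Definition hshift X Y (f : hHom X Y) : hHom (cshift X) (cshift Y) :=
  hclass (cm_shift (hrepr f)).

Lemma hshiftE X Y (f : chain_map X Y) :
  hshift (hclass f) = hclass (cm_shift f).
Proof.
have /hclassP/null_homotopic_shift f'f := hreprK (hclass f).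
apply/hclassP; rewrite (_ : _ - _ = cm_shift (hrepr (hclass f) - f)) //.
exact: chain_mapP.
Qed.

Lemma hshift_id X : hshift (hclass (cm_id X)) = hclass (cm_id (cshift X)).
Proof. by rewrite hshiftE; congr hclass; apply: chain_mapP. Qed.

Lemma hshift_comp X Y Z (g : hHom Y Z) (f : hHom X Y) :
  hshift (hcomp g f) = hcomp (hshift g) (hshift f).
Proof.
rewrite -(hreprK g) -(hreprK f) hcompE !hshiftE hcompE; congr hclass.
exact: chain_mapP.
Qed.

Lemma hshiftD X Y (f g : hHom X Y) : hshift (f + g) = hshift f + hshift g.
Proof.
rewrite -(hreprK f) -(hreprK g) -hclassD !hshiftE -hclassD; congr hclass.
exact: chain_mapP.
Qed.

Section Cone.
Variables (X Y : bcomplex) (f : chain_map X Y).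

Program Definition cone : bcomplex :=
  @BComplex (fun i => X (i + 1) \oplus Y i)
    (fun i => in1 \oc (- diff X (i + 1)) \oc pr1
            + in2 \oc (- f (i + 1)) \oc pr1
            + in2 \oc diff Y i \oc pr2) _ _.
Next Obligation.
move=> i /=; rewrite !(compDl, compDr) !compA.
rewrite -!(compA _ pr1) -!(compA _ pr2) !(pr1_in1, pr2_in2, pr1_in2, pr2_in1).
rewrite !(compm1, compm0, comp0m) -!(compA in1) -!(compA in2).
rewrite !(compNm, compmN) !opprK !diffK cmapP !(compm0, comp0m).
by rewrite !(add0r, addr0) subrr.
Qed.
Next Obligation.
case: (bounded X) => s sP; case: (bounded Y) => t tP.
exists ([seq i - 1 | i <- s] ++ t) => i.
rewrite mem_cat negb_or => /andP[si ti]; apply: is_zero_bip; last exact: tP.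
by apply: sP; apply: contra si => si; apply/mapP; exists (i + 1); rewrite ?addrK.
Qed.

Program Definition cone_in : chain_map Y cone :=
  @ChainMap Y cone (fun i => in2) _.
Next Obligation.
move=> i /=; rewrite !compDl -!compA pr1_in2 pr2_in2.
by rewrite !(compm1, compm0) !add0r.
Qed.

(* Because the cone carries [- f] in its differential, the standard third map
   of the triangle is minus the projection. *)
Program Definition cone_out : chain_map cone (cshift X) :=
  @ChainMap cone (cshift X) (fun i => - pr1) _.
Next Obligation.
move=> i /=; rewrite !compDr !compNm !compmN !compA !(compNm, compmN) !compA.
by rewrite pr1_in1 pr1_in2 !(comp1m, comp0m) !oppr0 !addr0.
Qed.

End Cone.

Definition Kb_distinguished (C1 C2 C3 : bcomplex)
    (u : hHom C1 C2) (v : hHom C2 C3) (w : hHom C3 (cshift C1)) : Prop :=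
  exists (X Y : bcomplex) (f : chain_map X Y)
    (a1 : hHom C1 X) (a2 : hHom C2 Y) (a3 : hHom C3 (cone f)),
    [/\ @is_iso Kb_add C1 X a1, @is_iso Kb_add C2 Y a2
      & @is_iso Kb_add C3 (cone f) a3] /\
    [/\ hcomp a2 u = hcomp (hclass f) a1,
        hcomp a3 v = hcomp (hclass (cone_in f)) a2
      & hcomp (hshift a1) w = hcomp (hclass (cone_out f)) a3].

Definition Kb : triData :=
  @TriData Kb_add cshift hshift hshift_id hshift_comp hshiftD Kb_distinguished.

End Complexes.

(* Main.v *)
Require Import Defs.
From HB Require Import structures.
From mathcomp Require Import all_boot all_order all_algebra.
From mathcomp Require Import generic_quotient ring_quotient.
From mathcomp Require Import ssrAC boolp classical_sets fsbigop.
From mathcomp Require Import freeg zify.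
Require Import Defs.

(** The two groups are identified by the maps

      phi : <B> |-> <B placed in degree 0>,
      psi : <X> |-> sum over i of (-1)^i <X^i>  (the Euler class of X).

    Since psi (phi <B>) = <B>, the theorem follows once both maps are known to
    be well defined and phi is known to be surjective.

    Well-definedness of psi ([euler_lift]).  The Euler class of a cone is
    visibly the difference of the Euler classes of target and source
    ([euler_cone]), so everything rests on homotopy invariance.  As the cone of
    a homotopy equivalence is contractible ([cone_contractible]), it is enough
    that a contractible bounded complex has Euler class zero
    ([euler_contractible]).  Idempotents need not split in A, so the kernels of
    the differentials are not available; instead the sum of the terms of even
    degree and the sum of the terms of odd degree are compared directly.  A
    contracting homotopy h can be chosen with h h = 0 ([contraction_sq0]), and
    then (d + h)(d + h) = d h + h d = 1, so that d + h, which exchanges the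
    even and the odd sum, is an isomorphism between them ([folded_K]).

    Well-definedness and surjectivity of phi.  A short exact sequence of
    complexes that splits in every degree gives a relation in the triangulated
    Grothendieck group, because its third term is homotopy equivalent to the
    cone of its first map ([tri_class_split_exact]).  Direct sums give the
    additivity of phi ([tri_lift]), the sequence of a cone gives
    <X[1]> = - <X> ([tri_class_shift]), and the brutal truncations express
    every class through classes of complexes concentrated in one degree, hence
    through the image of phi ([tri_class_generated]). *)

Set Implicit Arguments.
Unset Strict Implicit.
Unset Printing Implicit Defensive.

Import GRing.Theory.
Local Open Scope ring_scope.
Local Open Scope quotient_scope.
Local Open Scope cat_scope.
Local Obligation Tactic := idtac.

(** * Abelian groups given by generators and relations *)

Section Presented.
Variables (T : choiceType) (R : {freeg T} -> Prop).

Definition generator (t : T) : presented R := \pi_(presented R) << t >>.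

Lemma pi_relation r : R r -> \pi_(presented R) r = 0.
Proof.
move=> Rr; rewrite -(raddf0 (\pi_(presented R))); apply/eqP.
rewrite -Quotient.idealrBE subr0; apply/asboolP => S; exact.
Qed.

Lemma presented_ind (P : presented R -> Prop) :
  P 0 -> (forall x y, P x -> P y -> P (x - y)) -> (forall t, P (generator t)) ->
  forall x, P x.
Proof.
move=> P0 PB Pt x; have PN y : P y -> P (- y) by rewrite -sub0r; exact: PB.
have PD y z : P y -> P z -> P (y + z).
  by move=> Py Pz; rewrite -[z]opprK; apply: PB => //; exact: PN.
rewrite -[x]reprK -[repr x]freeg_sumE.
elim: (dom _) => [|t s IHs]; first by rewrite big_nil raddf0.
rewrite big_cons raddfD; apply: (PD) => //; move: (coeff _ _) => k.
have -> : << k *g t >> = << t >> *~ k by rewrite freegU_mulz intz.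
rewrite raddfMz; have PM n : P (generator t *+ n).
  by elim: n => [|n IHn]; rewrite ?mulr0n // mulrS; apply: PD.
by case: k => n; [exact: PM | rewrite NegzE mulrNz; apply/PN/PM].
Qed.

(** The kernel of g is a subgroup containing the relations, so it contains
    everything that the quotient kills. *)
Lemma presented_lift (V : zmodType) (f : T -> V)
    (g : {additive {freeg T} -> V}) :
    (forall t, g << t >> = f t) -> (forall r, R r -> g r = 0) ->
  exists phi : {additive presented R -> V}, forall t, phi (generator t) = f t.
Proof.
move=> gE gR; pose K : {pred {freeg T}} := fun x => g x == 0.
have Kzmod : zmod_closed K.
  split=> [|x y]; rewrite !unfold_in ?raddf0 // raddfB => /eqP-> /eqP->.
  by rewrite subr0.
pose S : zmodClosed {freeg T} := HB.pack K (GRing.isZmodClosed.Build _ K Kzmod).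
have kerg x y : x = y %[mod Quotient.quot (relsub R)] -> g x = g y.
  move=> /eqP; rewrite -Quotient.idealrBE => /asboolP/(_ S) xyK.
  apply/eqP; rewrite -subr_eq0 -raddfB.
  by apply: xyK => r /gR; rewrite unfold_in /= /K => ->.
pose phi (x : presented R) := g (repr (x : Quotient.quot (relsub R))).
have phiB : zmod_morphism phi.
  move=> x y; rewrite /phi -raddfB; apply: kerg.
  have piK (z : Quotient.quot (relsub R)) :
    \pi_(Quotient.quot (relsub R)) (repr z) = z by exact: reprK.
  by rewrite raddfB /= !piK.
pose Phi : {additive presented R -> V} :=
  HB.pack phi (GRing.isZmodMorphism.Build _ _ phi phiB).
by exists Phi => t; rewrite -gE; apply: kerg; exact: reprK.
Qed.
End Presented.

Lemma free_lift (T : choiceType) (V : zmodType) (f : T -> V) :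
  exists g : {additive {freeg T} -> V}, forall t, g << t >> = f t.
Proof.
(* Lifting out of the free group is linear over the integers, so the target is
   viewed as a module over them. *)
pose f' : T -> zmodule V := f.
pose g0 : {freeg T} -> V := fglift f'.
have gB : zmod_morphism g0 by exact: (lift_is_additive f').
pose g : {additive {freeg T} -> V} :=
  HB.pack g0 (GRing.isZmodMorphism.Build _ _ g0 gB).
by exists g => t; rewrite /= /g0 liftU scale1r.
Qed.

(** * Split Grothendieck group and finite biproducts *)

Section SplitClasses.
Variable A : addCat.
Implicit Types X Y : A.

Definition split_class X : K_split A := generator (@split_rel A) (class_of X).

Lemma split_class_bip X Y :
  split_class (X \oplus Y) = split_class X + split_class Y.
Proof.
apply/eqP; rewrite -subr_eq0; apply/eqP.
rewrite /split_class /generator -!raddfD -raddfB; apply: pi_relation.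
by exists X, Y.
Qed.

Lemma split_class_iso X Y : isomorphic X Y -> split_class X = split_class Y.
Proof. by move=> /class_ofP XY; rewrite /split_class XY. Qed.

Lemma is_zero_iso X Y : is_zero X -> is_zero Y -> isomorphic X Y.
Proof.
move=> [X1 _] [Y1 _]; exists 0, 0.
by rewrite (X1 _ (idm X)) (Y1 _ (idm Y)) !comp0m.
Qed.

(** The sum of a zero object X with itself is isomorphic to X, so <X> is equal
    to its own double. *)
Lemma split_class0 X : is_zero X -> split_class X = 0.
Proof.
move=> X0; apply: (addrI (split_class X)); rewrite addr0 -split_class_bip.
apply: split_class_iso.
by apply: is_zero_iso => //; exact: is_zero_bip.
Qed.

Lemma comp_suml I (s : seq I) X Y Z (F : I -> (Y ~> Z)) (f : X ~> Y) :
  (\sum_(i <- s) F i) \oc f = \sum_(i <- s) F i \oc f.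
Proof.
by apply: (big_morph (fun g => g \oc f)) => [g h|]; rewrite ?compDl ?comp0m.
Qed.

Lemma comp_sumr I (s : seq I) X Y Z (F : I -> (X ~> Y)) (f : Y ~> Z) :
  f \oc (\sum_(i <- s) F i) = \sum_(i <- s) f \oc F i.
Proof.
by apply: (big_morph (fun g => f \oc g)) => [g h|]; rewrite ?compDr ?compm0.
Qed.

Section FiniteBiproducts.
Variables (I : eqType) (X : I -> A).

(** The injections and projections are indexed by all of I, with zero injections
    outside s: sums of morphisms can then be formed without carrying membership
    proofs around.  The last field records the class of the sum, which is read
    off along the construction. *)
Record fbip (s : seq I) := FBip {
  fob :> A;
  fin : forall i, X i ~> fob;
  fpr : forall i, fob ~> X i;
  fpr_in : forall i, i \in s -> fpr i \oc fin i = idm (X i);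
  fpr_in0 : forall i j, i != j -> fpr i \oc fin j = 0;
  fin0 : forall i, i \notin s -> fin i = 0;
  fbip_id : \sum_(i <- s) fin i \oc fpr i = idm fob;
  fbip_class : split_class fob = \sum_(i <- s) split_class (X i)
}.

(** The Kronecker delta; when the indices agree, the identity has to be
    transported along the equality i = j. *)
Definition kron i j : X i ~> X j :=
  match i =P j with
  | ReflectT e => ecast k (X i ~> X k) e (idm (X i))
  | ReflectF _ => 0
  end.

Lemma kronii i : kron i i = idm (X i).
Proof. by rewrite /kron; case: eqP => // e; rewrite eq_axiomK. Qed.

Lemma kron0 i j : i != j -> kron i j = 0.
Proof. by rewrite /kron; case: eqP. Qed.

(** Induction on s, adding one summand at a time with a binary biproduct.
    Distinctness of the entries keeps the new injection orthogonal to the old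
    ones. *)
Lemma fbip_exists s : uniq s -> inhabited (fbip s).
Proof.
elim: s => [_|i s IHs /= /andP[iNs /IHs[B]]].
  apply: inhabits; apply: (@FBip _ zob (fun=> 0) (fun=> 0)) => //.
  - by move=> i j _; rewrite comp0m.
  - by rewrite big_nil; apply/esym/zob_initial.
  - by rewrite big_nil split_class0 //; exact: is_zero_zob.
apply: inhabits; apply: (@FBip _ (X i \oplus B)
  (fun j => in1 \oc kron j i + in2 \oc fin B j)
  (fun j => kron i j \oc pr1 + fpr B j \oc pr2)).
- move=> j; rewrite inE compDl !compDr -!compA !(compA pr1) !(compA pr2).
  rewrite pr1_in1 pr1_in2 pr2_in1 pr2_in2 !comp0m !comp1m !compm0 add0r addr0.
  case: eqVneq => [-> _|ji /= js].
    by rewrite kronii (fin0 _ iNs) comp1m compm0 addr0.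
  by rewrite (fpr_in _ js) (kron0 ji) compm0 add0r.
- move=> j k jk; rewrite compDl !compDr -!compA !(compA pr1) !(compA pr2).
  rewrite pr1_in1 pr1_in2 pr2_in1 pr2_in2 !comp0m !comp1m !compm0 add0r addr0.
  rewrite fpr_in0 // addr0; case: (eqVneq k i) jk => [-> ji|ki _].
    by rewrite (@kron0 i) ?comp0m // eq_sym.
  by rewrite (kron0 ki) compm0.
- move=> j; rewrite inE negb_or => /andP[ji js].
  by rewrite (kron0 ji) (fin0 _ js) !compm0 addr0.
- rewrite big_cons kronii (fin0 _ iNs) comp1m compm0 compm1 addr0 compDr.
  have -> : in1 \oc (fpr B i \oc pr2) = 0 :> (X i \oplus B ~> X i \oplus B).
    have -> : fpr B i = 0; last by rewrite comp0m compm0.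
    rewrite -[LHS]compm1 -fbip_id comp_sumr big1_seq // => j /andP[_ js].
    rewrite compA fpr_in0 ?comp0m //.
    by apply: contraNneq iNs => ->.
  rewrite addr0 -bip_id; congr (_ + _).
  rewrite -[in2 in RHS]compm1 -fbip_id comp_sumr comp_suml.
  apply: eq_big_seq => j js; have ji : j != i by apply: contraNneq iNs => <-.
  by rewrite (kron0 ji) (@kron0 i j) 1?eq_sym // compm0 comp0m !add0r !compA.
- by rewrite split_class_bip big_cons fbip_class.
Qed.

End FiniteBiproducts.
End SplitClasses.

(** * Euler classes of contractible complexes and of cones *)

Definition parity (i : int) : bool := odd `|i|%N.

Lemma parityS i : parity (i + 1) = ~~ parity i.
Proof.
rewrite /parity; case: i => [n|[//|n]]; first by rewrite -PoszD !absz_nat addn1.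
rewrite (_ : Negz n.+1 + 1 = Negz n) ?NegzE ?abszN /= ?negbK //.
by rewrite -addn1 PoszD opprD addrNK.
Qed.

Definition alt (V : zmodType) (i : int) (x : V) : V :=
  if parity i then - x else x.

Lemma altS (V : zmodType) i (x : V) : alt (i + 1) x = - alt i x.
Proof. by rewrite /alt parityS; case: (parity i); rewrite ?opprK. Qed.

Section Complexes.
Variable A : addCat.
Implicit Types X Y Z : bcomplex A.

Lemma bounded_uniq X :
  exists2 s : seq int, uniq s & forall i : int, i \notin s -> is_zero (X i).
Proof.
case: (bounded X) => s sP; exists (undup s); first exact: undup_uniq.
by move=> i; rewrite mem_undup; exact: sP.
Qed.

(** As for homotopies, the equation is written in degree i + 1, so that h i and
    diff X i are composable without transport along i - 1 + 1 = i. *)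
Definition contraction X (h : forall i : int, X (i + 1) ~> X i) : Prop :=
  forall i, idm (X (i + 1)) = diff X i \oc h i + h (i + 1) \oc diff X (i + 1).

Definition contractible X : Prop := exists h, @contraction X h.

(** Replace h by h d h.  Put p = d h and q = h d, so that p + q = 1.  Since
    q p = h d d h = 0, p and q are complementary idempotents and p q = 0; so
    h d h is again a contraction, and its square is h p q h = 0. *)
Lemma contraction_sq0 X : contractible X ->
  exists2 h, @contraction X h & forall i, h i \oc h (i + 1) = 0.
Proof.
move=> [h hP]; pose p i := diff X i \oc h i.
pose q i := h (i + 1) \oc diff X (i + 1).
have pq1 i : p i + q i = idm (X (i + 1)) by rewrite [RHS]hP.
have qp i : q i \oc p i = 0.
  by rewrite /q /p -compA (compA (diff _ _) (diff _ _)) diffK comp0m compm0.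
have pp i : p i \oc p i = p i.
  by rewrite -[RHS]comp1m -pq1 compDl qp addr0.
have pq i : p i \oc q i = 0.
  by apply: (addrI (p i)); rewrite -{1}pp -compDr pq1 compm1 addr0.
have qq i : q i \oc q i = q i.
  by rewrite -[RHS]comp1m -pq1 compDl pq add0r.
exists (fun i => h i \oc p i) => i.
  rewrite compA -/(p i) pp -pq1; congr (_ + _).
  by rewrite /p compA -compA -/(q i) qq.
have -> : h (i + 1) \oc p (i + 1) = q i \oc h (i + 1) by rewrite /p /q compA.
by rewrite -compA (compA (p i)) pq comp0m compm0.
Qed.

Section Parity.
Variables (X : bcomplex A) (h : forall i : int, X (i + 1) ~> X i).
Hypotheses (hP : @contraction X h) (hh : forall i, h i \oc h (i + 1) = 0).
Variable s : seq int.
Hypotheses (s_uniq : uniq s) (sP : forall i : int, i \notin s -> is_zero (X i)).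

(** The morphism d + h between the sum of the terms of one parity and the sum of
    the terms of the other one.  The summand X (k + 1) is sent to X (k + 2) by d
    and to X k by h, so k runs over the degrees of s lowered by one. *)
Definition folded (B C : A) (pB : forall i, B ~> X i)
    (jC : forall i : int, X i ~> C) : B ~> C :=
  \sum_(k <- [seq i - 1 | i <- s])
    (jC (k + 1 + 1) \oc diff X (k + 1) + jC k \oc h k) \oc pB (k + 1).

(** The assumption on the parity of k + 1 is what makes this hold when the
    summand X (k + 1) is missing from B: it is missing only if it lies outside
    s, and then it is a zero object. *)
Lemma folded_in b r r' (B : fbip X r) (C : fbip X r') k :
    r =i [pred i | (i \in s) && (parity i == b)] -> parity (k + 1) = b ->
  folded (@fpr _ _ _ _ B) (@fin _ _ _ _ C) \oc fin B (k + 1) =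
  fin C (k + 1 + 1) \oc diff X (k + 1) + fin C k \oc h k.
Proof.
move=> rP kb; have [ks|/sP[X0 _]] := boolP (k + 1 \in s); last first.
  by rewrite [LHS]X0 [RHS]X0.
rewrite comp_suml (bigD1_seq k) /=; first last.
- by rewrite map_inj_uniq //; exact: addIr.
- by apply/mapP; exists (k + 1); rewrite ?addrK.
rewrite -compA fpr_in ?compm1; last by rewrite rP inE ks kb eqxx.
rewrite big1 ?addr0 // => i ik; rewrite -compA fpr_in0 ?compm0 //.
by rewrite (inj_eq (@addIr _ 1)).
Qed.

(** (d + h)(d + h) = d d + (d h + h d) + h h = 1, checked on each summand. *)
Lemma folded_K b r r' (B : fbip X r) (C : fbip X r') :
    r =i [pred i | (i \in s) && (parity i == b)] ->
    r' =i [pred i | (i \in s) && (parity i == ~~ b)] ->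
  folded (@fpr _ _ _ _ C) (@fin _ _ _ _ B) \oc
    folded (@fpr _ _ _ _ B) (@fin _ _ _ _ C) = idm B.
Proof.
move=> rP r'P; rewrite -[LHS]compm1 -fbip_id comp_sumr; apply: eq_big_seq => i.
rewrite rP inE => /andP[_ /eqP ib]; rewrite compA; congr (_ \oc _).
(* The components of d + h are described in degrees of the form k + 1, and the
   second application lands in degrees i + 1 and i - 1. *)
have [m im] : exists m : int, i = m + 1 + 1.
  by exists (i - 1 - 1); rewrite !subrK.
rewrite {i}im in ib *; rewrite -compA (folded_in B C rP ib) compDr !compA.
rewrite !(folded_in C B r'P) ?parityS -?ib ?parityS ?negbK //.
rewrite !compDl -!compA diffK compm0 add0r hh compm0 addr0.
by rewrite [LHS]addrC -compDr -hP compm1.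
Qed.

Lemma folded_class :
  \sum_(i <- s | parity i) split_class (X i) =
  \sum_(i <- s | ~~ parity i) split_class (X i).
Proof.
pose r b := [seq i <- s | parity i == b].
have rP b : r b =i [pred i | (i \in s) && (parity i == b)].
  by move=> i; rewrite mem_filter inE andbC.
have [B] := fbip_exists X (filter_uniq (fun i => parity i == true) s_uniq).
have [C] := fbip_exists X (filter_uniq (fun i => parity i == false) s_uniq).
have BC : isomorphic B C.
  exists (folded (@fpr _ _ _ _ B) (@fin _ _ _ _ C)).
  exists (folded (@fpr _ _ _ _ C) (@fin _ _ _ _ B)).
  by split; [exact: (folded_K _ _ (rP true) (rP false))
            |exact: (folded_K _ _ (rP false) (rP true))].
have := split_class_iso BC; rewrite !fbip_class !big_filter.
under eq_bigl do rewrite eqb_id.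
by under [in RHS]eq_bigl do rewrite eqbF_neg.
Qed.
End Parity.

(** All degrees are summed over: boundedness makes the support finite, and no
    bounding list has to be chosen. *)
Definition euler X : K_split A :=
  \sum_(i \in [set: int]) alt i (split_class (X i)).

Lemma eulerE X (s : seq int) : uniq s ->
  (forall i : int, i \notin s -> is_zero (X i)) ->
  euler X = \sum_(i <- s) alt i (split_class (X i)).
Proof.
move=> us sP; rewrite (bigfs _ us) => [|i _ /sP X0].
  by congr (\big[_/_]_(_ \in _) _); apply/seteqP; split.
by rewrite split_class0 // /alt oppr0 if_same.
Qed.

Lemma euler_contractible X : contractible X -> euler X = 0.
Proof.
move=> /contraction_sq0[h hP hh]; have [s us sP] := bounded_uniq X.
rewrite (eulerE us sP) (bigID parity) /=.
rewrite (eq_bigr (fun i => - split_class (X i))) => [|i]; last first.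
  by rewrite /alt => ->.
rewrite sumrN (folded_class hP hh us sP) addrC; apply/eqP; rewrite subr_eq0.
by apply/eqP/eq_bigr => i /negbTE; rewrite /alt => ->.
Qed.

(** The cone has terms X (i + 1) + Y i, and shifting the index by one changes
    the sign of the contribution of X. *)
Lemma euler_cone X Y (f : chain_map X Y) : euler (cone f) = euler Y - euler X.
Proof.
have [s us sP] := bounded_uniq X; have [t ut tP] := bounded_uniq Y.
pose r := undup (s ++ t ++ [seq i - 1 | i <- s]).
have ur : uniq r by exact: undup_uniq.
have rX i : i \notin r -> is_zero (X i).
  by rewrite mem_undup !mem_cat !negb_or => /and3P[/sP].
have rY i : i \notin r -> is_zero (Y i).
  by rewrite mem_undup !mem_cat !negb_or => /and3P[_ /tP].
have rX1 i : i \notin r -> is_zero (X (i + 1)).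
  rewrite mem_undup !mem_cat !negb_or => /and3P[_ _ si]; apply: sP.
  by apply: contra si => si; apply/mapP; exists (i + 1); rewrite ?addrK.
rewrite (eulerE ur rY) [euler (cone f)](eulerE ur) => [|i ir]; last first.
  by apply: is_zero_bip; [exact: rX1 | exact: rY].
have -> : euler X = - \sum_(i <- r) alt i (split_class (X (i + 1))).
  rewrite -sumrN; under eq_bigr do rewrite -altS.
  rewrite -(big_map (fun i => i + 1) xpredT
    (fun i => alt i (split_class (X i)))).
  apply: eulerE => [|i ir]; first by rewrite map_inj_uniq //; exact: addIr.
  rewrite -[i](subrK 1); apply: rX1; apply: contra ir => ir.
  by apply/mapP; exists (i - 1); rewrite ?subrK.
rewrite opprK addrC -big_split /=; apply: eq_bigr => i _.
by rewrite split_class_bip /alt; case: ifP => _ //; rewrite opprD.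
Qed.

End Complexes.

(** * Cones of homotopy equivalences *)

Section Matrices.
Variable A : addCat.
Implicit Types P Q : A.

(** Morphisms between binary biproducts as 2 x 2 matrices acting on columns. *)
Definition mat P1 P2 Q1 Q2 (a : P1 ~> Q1) (b : P2 ~> Q1) (c : P1 ~> Q2)
    (d : P2 ~> Q2) : P1 \oplus P2 ~> Q1 \oplus Q2 :=
  in1 \oc (a \oc pr1 + b \oc pr2) + in2 \oc (c \oc pr1 + d \oc pr2).

Lemma mat_id P1 P2 : mat (idm P1) 0 0 (idm P2) = idm (P1 \oplus P2).
Proof. by rewrite /mat !comp0m !comp1m addr0 add0r bip_id. Qed.

Lemma matD P1 P2 Q1 Q2 (a a' : P1 ~> Q1) (b b' : P2 ~> Q1) (c c' : P1 ~> Q2)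
    (d d' : P2 ~> Q2) :
  mat a b c d + mat a' b' c' d' = mat (a + a') (b + b') (c + c') (d + d').
Proof.
rewrite /mat addrACA -!compDr; congr (in1 \oc _ + in2 \oc _);
by rewrite addrACA !compDl.
Qed.

Lemma matN P1 P2 Q1 Q2 (a : P1 ~> Q1) (b : P2 ~> Q1) (c : P1 ~> Q2)
    (d : P2 ~> Q2) : - mat a b c d = mat (- a) (- b) (- c) (- d).
Proof. by rewrite /mat !compNm -!opprD !compmN -opprD. Qed.

Lemma matM P1 P2 Q1 Q2 R1 R2 (a : P1 ~> Q1) (b : P2 ~> Q1) (c : P1 ~> Q2)
    (d : P2 ~> Q2) (a' : Q1 ~> R1) (b' : Q2 ~> R1) (c' : Q1 ~> R2)
    (d' : Q2 ~> R2) :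
  mat a' b' c' d' \oc mat a b c d =
  mat (a' \oc a + b' \oc c) (a' \oc b + b' \oc d)
      (c' \oc a + d' \oc c) (c' \oc b + d' \oc d).
Proof.
have p1 : pr1 \oc mat a b c d = a \oc pr1 + b \oc pr2.
  by rewrite /mat compDr !compA pr1_in1 pr1_in2 comp0m comp1m addr0.
have p2 : pr2 \oc mat a b c d = c \oc pr1 + d \oc pr2.
  by rewrite /mat compDr !compA pr2_in1 pr2_in2 comp0m comp1m add0r.
rewrite {1}/mat compDl -!compA !compDl -!compA p1 p2.
by congr (in1 \oc _ + in2 \oc _); rewrite !compDr !compA addrACA -!compDl.
Qed.

Lemma mat_col P1 P2 Q1 Q2 R (a : P1 ~> Q1) (b : P2 ~> Q1) (c : P1 ~> Q2)
    (d : P2 ~> Q2) (x : R ~> P1) (y : R ~> P2) :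
  mat a b c d \oc (in1 \oc x + in2 \oc y) =
  in1 \oc (a \oc x + b \oc y) + in2 \oc (c \oc x + d \oc y).
Proof.
have p1 : pr1 \oc (in1 \oc x + in2 \oc y) = x.
  by rewrite compDr !compA pr1_in1 pr1_in2 comp0m comp1m addr0.
have p2 : pr2 \oc (in1 \oc x + in2 \oc y) = y.
  by rewrite compDr !compA pr2_in1 pr2_in2 comp0m comp1m add0r.
by rewrite /mat compDl -!compA !compDl -!compA p1 p2.
Qed.

Lemma mat_row P1 P2 Q1 Q2 R (a : P1 ~> Q1) (b : P2 ~> Q1) (c : P1 ~> Q2)
    (d : P2 ~> Q2) (x : Q1 ~> R) (y : Q2 ~> R) :
  (x \oc pr1 + y \oc pr2) \oc mat a b c d =
  (x \oc a + y \oc c) \oc pr1 + (x \oc b + y \oc d) \oc pr2.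
Proof.
have p1 : pr1 \oc mat a b c d = a \oc pr1 + b \oc pr2.
  by rewrite /mat compDr !compA pr1_in1 pr1_in2 comp0m comp1m addr0.
have p2 : pr2 \oc mat a b c d = c \oc pr1 + d \oc pr2.
  by rewrite /mat compDr !compA pr2_in1 pr2_in2 comp0m comp1m add0r.
by rewrite compDl -!compA p1 p2 !compDr !compDl !compA addrACA.
Qed.
End Matrices.

Section ConeContraction.
Variable A : addCat.
Implicit Types X Y Z : bcomplex A.

Lemma cone_diffE X Y (f : chain_map X Y) i :
  diff (cone f) i = mat (- diff X (i + 1)) 0 (- f (i + 1)) (diff Y i).
Proof. by rewrite /= /mat comp0m addr0 compDr !compA addrA. Qed.

(** Let H and K be the homotopies from 1 to g f and from 1 to f g.  The matrix
    with rows (-H, -g) and (0, K) is almost a contraction: the equation fails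
    only in the lower left corner, by the defect N = f H - K f, which satisfies
    d N = - N d.  Subtracting N times the first row from the second one repairs
    this corner, and leaves the lower right one correct because
    d N g + N g d = d N g + N d g = 0. *)
Lemma cone_contractible X Y (f : chain_map X Y) (g : chain_map Y X) :
    cm_id X - cm_comp g f \in @null_homotopic A X X ->
    cm_id Y - cm_comp f g \in @null_homotopic A Y Y ->
  contractible (cone f).
Proof.
move=> /asboolP[H /= HP] /asboolP[K /= KP].
pose N i : X (i + 1) ~> Y i := f i \oc H i - K i \oc f (i + 1).
have dH i : diff X i \oc H i =
    idm (X (i + 1)) - g (i + 1) \oc f (i + 1) - H (i + 1) \oc diff X (i + 1).
  by rewrite HP addrK.
have dK i : diff Y i \oc K i =
    idm (Y (i + 1)) - f (i + 1) \oc g (i + 1) - K (i + 1) \oc diff Y (i + 1).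
  by rewrite KP addrK.
have dN i : diff Y i \oc N i = - (N (i + 1) \oc diff X (i + 1)).
  rewrite /N compDr compmN compA cmapP -compA dH (compA (diff Y i)) dK.
  rewrite !(compDl, compDr, compNm, compmN) compm1 comp1m -!compA -cmapP.
  by rewrite opprB [LHS]addrC addrA subrK opprB addrC.
have NdE i : N i = f i \oc H i - K i \oc f (i + 1) by [].
(* Otherwise N would be unfolded by distributivity. *)
clearbody N.
exists (fun i => mat (- H (i + 1)) (- g (i + 1)) (N i \oc H (i + 1))
  (K i + N i \oc g (i + 1))) => i.
rewrite !cone_diffE !matM matD -[LHS]mat_id; congr mat.
- rewrite comp0m addr0 !compNm !compmN !opprK dH.
  by rewrite addrA subrK addrNK.
- rewrite compm0 add0r comp0m addr0 !compNm !compmN !opprK cmapP.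
  by rewrite subrr.
- have NE : N (i + 1) = N (i + 1) \oc (diff X (i + 1) \oc H (i + 1) +
      H (i + 1 + 1) \oc diff X (i + 1 + 1) + g (i + 1 + 1) \oc f (i + 1 + 1)).
    by rewrite -HP subrK compm1.
  rewrite -[LHS](subrr (N (i + 1))) {2}NE {1}NdE.
  rewrite !(compDl, compDr, compNm, compmN) opprK !compA dN !compNm !opprD.
  by rewrite [LHS](AC (2*3) ((1*3)*(4*(2*5)))).
- rewrite compm0 add0r !(compDl, compDr, compNm, compmN) opprK !compA dN.
  rewrite -(compA (N _) (g _)) -cmapP compA compNm dK.
  by rewrite [RHS](AC ((1*2)*2) ((2*4*1)*(3*5))) /= !subrK addNr addr0.
Qed.

End ConeContraction.

(** * Relations in the triangulated Grothendieck group *)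

Section TriangulatedClasses.
Variable A : addCat.
Implicit Types X Y Z T W : bcomplex A.

Lemma homotopy_equiv_isomorphic X Y (f : chain_map X Y) (g : chain_map Y X) :
    cm_id X - cm_comp g f \in @null_homotopic A X X ->
    cm_id Y - cm_comp f g \in @null_homotopic A Y Y ->
  @isomorphic (Kb A) X Y.
Proof.
move=> /hclassP gf /hclassP fg; exists (hclass f), (hclass g).
by split; rewrite /= hcompE.
Qed.

Lemma isomorphic_homotopy_equiv X Y : @isomorphic (Kb A) X Y ->
  exists (f : chain_map X Y) (g : chain_map Y X),
    cm_id X - cm_comp g f \in @null_homotopic A X X /\
    cm_id Y - cm_comp f g \in @null_homotopic A Y Y.
Proof.
move=> [f [g]]; rewrite -(hreprK f) -(hreprK g) /= !hcompE => -[gf fg].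
by exists (hrepr f), (hrepr g); split; apply/hclassP.
Qed.

Lemma euler_iso X Y : @isomorphic (Kb A) X Y -> euler X = euler Y.
Proof.
move=> /isomorphic_homotopy_equiv[f [g [gf fg]]].
have := euler_contractible (cone_contractible gf fg).
by rewrite euler_cone => /eqP; rewrite subr_eq0 => /eqP.
Qed.

Definition tri_class X : K_tri (Kb A) :=
  generator (@tri_rel (Kb A)) (@class_of (Kb A) X).

Lemma tri_class_iso X Y : @isomorphic (Kb A) X Y -> tri_class X = tri_class Y.
Proof. by move=> /class_ofP XY; rewrite /tri_class XY. Qed.

Lemma euler_lift :
  exists psi : {additive K_tri (Kb A) -> K_split A},
    forall X, psi (tri_class X) = euler X.
Proof.
pose e (t : iso_class (Kb A)) := euler (repr t : bcomplex A).
have eE X : e (@class_of (Kb A) X) = euler X.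
  by apply/euler_iso/class_ofP; rewrite /class_of reprK.
have [g gE] := free_lift e.
have [|psi psiE] := @presented_lift _ (@tri_rel (Kb A)) _ e g gE; last first.
  by exists psi => X; rewrite psiE eE.
move=> r [C1 [C2 [C3 [u [v [w]]]]]].
move=> [[X [Y [f [a1 [a2 [a3 [[i1 i2 i3] _]]]]]]] ->].
rewrite raddfB raddfD /= /free_class !gE !eE.
rewrite (@euler_iso C1 X) ?(@euler_iso C2 Y) ?(@euler_iso C3 (cone f));
  [|by exists a3|by exists a2|by exists a1].
by rewrite euler_cone [euler X + _]addrC subrK subrr.
Qed.

Lemma tri_class_cone X Y (f : chain_map X Y) :
  tri_class Y = tri_class X + tri_class (cone f).
Proof.
apply/eqP; rewrite -subr_eq0; apply/eqP.
rewrite /tri_class /generator -!raddfD -raddfB; apply: pi_relation.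
exists X, Y, (cone f), (hclass f), (hclass (cone_in f)), (hclass (cone_out f)).
split=> //; exists X, Y, f.
exists (hclass (cm_id X)), (hclass (cm_id Y)), (hclass (cm_id (cone f))).
have iso_id Z : @is_iso (Kb_add A) Z Z (hclass (cm_id Z)).
  by exists (idm (Z : Kb_add A)); rewrite comp1m.
by split=> //; rewrite hshift_id !hcomp1m !hcompm1.
Qed.

(** The projection P = (0, p) from the cone of j to W is a homotopy equivalence.
    Its inverse is B = (u, s), where u = t d s corrects the failure of the
    splitting s to commute with the differentials; P B = 1 strictly, and
    1 - B P is the boundary of the homotopy that sends the summand X of the cone
    to the summand T by - t. *)
Lemma tri_class_split_exact T X W (j : chain_map T X) (p : chain_map X W)
    (t : forall i, X i ~> T i) (s : forall i, W i ~> X i) :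
    (forall i, t i \oc j i = idm (T i)) ->
    (forall i, p i \oc s i = idm (W i)) ->
    (forall i, j i \oc t i + s i \oc p i = idm (X i)) ->
  tri_class X = tri_class T + tri_class W.
Proof.
move=> tj ps jt_sp; rewrite (tri_class_cone j); congr (_ + _).
have pj i : p i \oc j i = 0.
  apply: (addIr (p i \oc j i)); rewrite add0r.
  rewrite -{3}[j i]comp1m -jt_sp compDl compDr -!compA tj compm1.
  by rewrite (compA (p i) (s i)) ps comp1m.
have jt i : j i \oc t i = idm (X i) - s i \oc p i by rewrite -jt_sp addrK.
have dt i : diff T i \oc t i = t (i + 1) \oc diff X i \oc (j i \oc t i).
  by rewrite -compA (compA (diff X i)) cmapP -compA compA tj comp1m.
have Pc i : diff W i \oc (p i \oc pr2) =
    (p (i + 1) \oc pr2) \oc diff (cone j) i.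
  have -> : p (i + 1) \oc pr2 = 0 \oc pr1 + p (i + 1) \oc pr2
    :> (T (i + 1 + 1) \oplus X (i + 1) ~> W (i + 1)) by rewrite comp0m add0r.
  rewrite cone_diffE mat_row !comp0m !add0r compmN pj oppr0 comp0m add0r.
  by rewrite compA cmapP.
pose P : chain_map (cone j) W :=
  @ChainMap A (cone j) W (fun i => p i \oc pr2) Pc.
pose u i := t (i + 1) \oc diff X i \oc s i.
have pds i : p (i + 1) \oc diff X i \oc s i = diff W i.
  by rewrite -cmapP -compA ps compm1.
have Bc i : diff (cone j) i \oc (in1 \oc u i + in2 \oc s i)
    = (in1 \oc u (i + 1) + in2 \oc s (i + 1)) \oc diff W i.
  rewrite cone_diffE mat_col comp0m addr0 compDl -!compA !compNm.
  congr (in1 \oc _ + in2 \oc _).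
    rewrite /u !compA dt jt !(compDr, compmN, compDl, compNm) compm1.
    rewrite -(compA _ (diff X (i + 1)) (diff X i)) diffK.
    rewrite compm0 comp0m sub0r opprK.
    by rewrite -!compA !(compA (p _)) pds.
  rewrite /u !compA jt !(compDl, compNm) comp1m opprB subrK.
  by rewrite -!compA !(compA (p _)) pds.
pose B : chain_map W (cone j) :=
  @ChainMap A W (cone j) (fun i => in1 \oc u i + in2 \oc s i) Bc.
apply/tri_class_iso/(homotopy_equiv_isomorphic (f := P) (g := B));
  apply/asboolP.
  exists (fun i => mat 0 (- t (i + 1)) 0 0) => i.
  have -> : (cm_id (cone j) - cm_comp B P) (i + 1) =
      mat (idm _) (- (u (i + 1) \oc p (i + 1))) 0 (j (i + 1) \oc t (i + 1)).
    rewrite /= -mat_id jt.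
    have -> : (in1 \oc u (i + 1) + in2 \oc s (i + 1)) \oc (p (i + 1) \oc pr2) =
       mat 0 (u (i + 1) \oc p (i + 1)) 0 (s (i + 1) \oc p (i + 1))
       :> (T (i + 1 + 1) \oplus X (i + 1) ~> T (i + 1 + 1) \oplus X (i + 1)).
      by rewrite /mat !comp0m !add0r compDl !compA.
    by rewrite matN matD !oppr0 !addr0 sub0r.
  rewrite !cone_diffE !matM matD; congr mat.
  - by rewrite !compm0 !comp0m !add0r compNm compmN opprK tj.
  - rewrite !comp0m add0r addr0 compNm compmN opprK dt jt compDr compm1 compmN.
    by rewrite compNm [RHS]addrAC subrr sub0r /u !compA.
  - by rewrite !compm0 !comp0m !addr0.
  - by rewrite !compm0 !comp0m !addr0 compNm compmN opprK.
exists (fun i => 0) => i /=.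
rewrite comp0m compm0 addr0.
by rewrite -compA compDr !compA pr2_in1 pr2_in2 !comp0m add0r comp1m ps subrr.
Qed.

Lemma tri_class_bip X Y :
  tri_class (bip_complex X Y) = tri_class X + tri_class Y.
Proof.
apply: (tri_class_split_exact (j := cm_in1 X Y) (p := cm_pr2 X Y)
  (t := fun i => pr1) (s := fun i => in2)) => i /=.
- exact: pr1_in1.
- exact: pr2_in2.
- exact: bip_id.
Qed.

(** For any f : X -> Y, the sequence Y -> cone f -> X[1] splits in each degree,
    so <cone f> = <Y> + <X[1]>; for f = 1 the triangle of f says moreover that
    <cone f> = 0. *)
Lemma tri_class_shift X : tri_class (cshift X) = - tri_class X.
Proof.
apply/eqP; rewrite -addr_eq0 addrC.
have <- : tri_class (cone (cm_id X)) = tri_class X + tri_class (cshift X).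
  apply: (tri_class_split_exact
    (j := cone_in (cm_id X)) (p := cone_out (cm_id X))
    (t := fun i => pr2) (s := fun i => - in1)) => i /=.
  - exact: pr2_in2.
  - by rewrite compNm compmN opprK pr1_in1.
  - by rewrite compNm compmN opprK [LHS]addrC bip_id.
by apply/eqP/(addrI (tri_class X)); rewrite addr0 -tri_class_cone.
Qed.

Definition concentrated m X : Prop := forall i, i != m -> is_zero (X i).

Lemma concentrated_diff m X i : concentrated m X -> diff X i = 0.
Proof.
move=> Xm; have [im|/Xm[X0 _]] := eqVneq i m; last exact: X0.
have [_ X0] : is_zero (X (i + 1)); last exact: X0.
by apply: Xm; rewrite im -subr_eq0 addrAC subrr add0r.
Qed.

(** All differentials vanish, so a family of isomorphisms between the terms is
    automatically compatible with them. *)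
Lemma concentrated_iso m X Y : concentrated m X -> concentrated m Y ->
  isomorphic (X m) (Y m) -> @isomorphic (Kb A) X Y.
Proof.
move=> Xm Ym XYm; have XY i : isomorphic (X i) (Y i).
  have [->//|im] := eqVneq i m.
  by apply: is_zero_iso; [exact: Xm | exact: Ym].
pose f i : X i ~> Y i := sval (cid (XY i)).
pose g i : Y i ~> X i := sval (cid (svalP (cid (XY i)))).
have fgP i : g i \oc f i = idm (X i) /\ f i \oc g i = idm (Y i).
  exact: svalP (cid (svalP (cid (XY i)))).
clearbody f g.
have fc i : diff Y i \oc f i = f (i + 1) \oc diff X i.
  by rewrite !(concentrated_diff _ Xm, concentrated_diff _ Ym) comp0m compm0.
have gc i : diff X i \oc g i = g (i + 1) \oc diff Y i.
  by rewrite !(concentrated_diff _ Xm, concentrated_diff _ Ym) comp0m compm0.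
apply: (@homotopy_equiv_isomorphic X Y
  (@ChainMap A X Y f fc) (@ChainMap A Y X g gc)).
  rewrite (_ : _ - _ = 0) ?rpred0 //; apply: chain_mapP => i /=.
  by case: (fgP i) => -> _; rewrite subrr.
rewrite (_ : _ - _ = 0) ?rpred0 //; apply: chain_mapP => i /=.
by case: (fgP i) => _ ->; rewrite subrr.
Qed.

Section Truncation.
Variables (P : pred int) (X : bcomplex A).

(** The object B, or the zero object when b is false.  The maps to and from B
    make it possible to define truncated complexes without transports. *)
Definition cut (b : bool) (B : A) : A := if b then B else zob.
Definition cut_in b B : cut b B ~> B :=
  if b return cut b B ~> B then idm B else 0.
Definition cut_pr b B : B ~> cut b B :=
  if b return B ~> cut b B then idm B else 0.

Lemma cut_pr_in b B : cut_pr b B \oc cut_in b B = idm (cut b B).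
Proof.
case: b; rewrite /= ?comp1m // comp0m; apply/esym.
exact: (zob_initial (idm zob)).
Qed.

Lemma cut_in_pr b B : cut_in b B \oc cut_pr b B = if b then idm B else 0.
Proof. by case: b; rewrite /= ?comp1m ?comp0m. Qed.

Lemma cut_zero (b : bool) B : (b -> is_zero B) -> is_zero (cut b B).
Proof. by case: b => [|_]; [exact | exact: is_zero_zob]. Qed.

(** For an upward closed P this is a subcomplex of X, and for a downward closed
    P a quotient complex; two differentials compose to zero for any P. *)
Program Definition trunc : bcomplex A :=
  @BComplex A (fun i => cut (P i) (X i))
    (fun i => cut_pr (P (i + 1)) _ \oc diff X i \oc cut_in (P i) _) _ _.
Next Obligation.
move=> i /=; rewrite -!compA (compA (cut_in _ _) (cut_pr _ _)) cut_in_pr.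
case: (P (i + 1)); last by rewrite comp0m !compm0.
by rewrite comp1m (compA (diff X (i + 1))) diffK comp0m compm0.
Qed.
Next Obligation.
have [s sP] := bounded X; exists s => i /sP X0.
by apply: cut_zero.
Qed.
End Truncation.

Lemma tri_class_trunc (P : pred int) X : (forall i, P i -> P (i + 1)) ->
  tri_class X = tri_class (trunc P X) + tri_class (trunc (predC P) X).
Proof.
move=> PS.
have jc i : diff X i \oc cut_in (P i) (X i) =
    cut_in (P (i + 1)) _ \oc diff (trunc P X) i.
  rewrite /= !compA cut_in_pr; have := PS i; case: (P i) => /=.
    by move=> ->; rewrite ?comp1m.
  by rewrite !compm0.
have pc i : diff (trunc (predC P) X) i \oc cut_pr (~~ P i) (X i) =
    cut_pr (~~ P (i + 1)) _ \oc diff X i.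
  rewrite /= -!compA cut_in_pr; have := PS i; case: (P i) => /=.
    by move=> ->; rewrite //= !comp0m.
  by rewrite compm1.
pose j : chain_map (trunc P X) X :=
  @ChainMap A (trunc P X) X (fun i => cut_in (P i) (X i)) jc.
pose p : chain_map X (trunc (predC P) X) :=
  @ChainMap A X (trunc (predC P) X) (fun i => cut_pr (~~ P i) (X i)) pc.
apply: (tri_class_split_exact (j := j) (p := p)
  (t := fun i => cut_pr (P i) (X i))
  (s := fun i => cut_in (~~ P i) (X i))) => i.
- exact: cut_pr_in.
- exact: cut_pr_in.
- by rewrite /= !cut_in_pr; case: (P i); rewrite ?addr0 ?add0r.
Qed.

Program Definition single (m : int) (B : A) : bcomplex A :=
  @BComplex A (fun i => cut (i == m) B) (fun i => 0) _ _.
Next Obligation. by move=> m B i /=; rewrite comp0m. Qed.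
Next Obligation.
move=> m B; exists [:: m] => i; rewrite inE => /negbTE im.
by apply: cut_zero; rewrite im.
Qed.

Lemma single_concentrated m B : concentrated m (single m B).
Proof. by move=> i /negbTE im; apply: cut_zero; rewrite im. Qed.

Lemma single_at m B : single m B m = B.
Proof. by rewrite /= eqxx. Qed.

Lemma tri_class_concentrated m X : concentrated m X ->
  tri_class X = tri_class (single m (X m)).
Proof.
move=> Xm; apply/tri_class_iso/(concentrated_iso Xm (@single_concentrated _ _)).
by rewrite single_at; exact: isomorphic_refl.
Qed.

(** The shift lowers degrees: single m B is isomorphic to the shift of
    single (m + 1) B. *)
Lemma tri_class_singleS m B :
  tri_class (single m B) = - tri_class (single (m + 1) B).
Proof.
rewrite -tri_class_shift; apply/tri_class_iso/(@concentrated_iso m).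
- exact: single_concentrated.
- by move=> i im; apply: single_concentrated; rewrite (inj_eq (@addIr _ 1)).
- by rewrite [cshift _ m]single_at single_at; exact: isomorphic_refl.
Qed.

(** The relation between consecutive degrees says that the signed class does not
    depend on the degree. *)
Lemma tri_class_single m B :
  tri_class (single m B) = alt m (tri_class (single 0 B)).
Proof.
have altE (n : int) : alt (n + 1) (tri_class (single (n + 1) B)) =
    alt n (tri_class (single n B)).
  by rewrite altS [in RHS]tri_class_singleS /alt; case: ifP; rewrite ?opprK.
have altK n (x : K_tri (Kb A)) : alt n (alt n x) = x.
  by rewrite /alt; case: (parity n); rewrite ?opprK.
rewrite -[LHS](altK m); congr (alt m).
have -> : tri_class (single 0 B) = alt 0 (tri_class (single 0 B)) by [].
elim/int_rec: m => [//|n IHn|n IHn].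
  by rewrite -addn1 PoszD altE.
by rewrite -altE -IHn -addn1 PoszD opprD addrNK.
Qed.

End TriangulatedClasses.

Lemma euler_single (A : addCat) (B : A) : euler (single 0 B) = split_class B.
Proof.
rewrite (@eulerE _ _ [:: 0]) => [||i]; first by rewrite big_seq1.
  by [].
by rewrite inE; exact: single_concentrated.
Qed.

Lemma tri_lift (A : addCat) :
  exists phi : {additive K_split A -> K_tri (Kb A)},
    forall B, phi (split_class B) = tri_class (single 0 B).
Proof.
have single_iso (B C : A) : isomorphic B C ->
    tri_class (single 0 B) = tri_class (single 0 C).
  move=> BC; apply/tri_class_iso/(@concentrated_iso _ 0);
    [exact: single_concentrated | exact: single_concentrated|].
  by rewrite !single_at.
pose e (t : iso_class A) := tri_class (single 0 (repr t : A)).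
have eE B : e (class_of B) = tri_class (single 0 B).
  by apply/single_iso/class_ofP; rewrite /class_of reprK.
have [g gE] := free_lift e.
have [|phi phiE] := @presented_lift _ (@split_rel A) _ e g gE; last first.
  by exists phi => B; rewrite phiE eE.
move=> r [B [C ->]]; rewrite raddfB raddfD /= /free_class.
rewrite !gE !eE -tri_class_bip.
apply/eqP; rewrite subr_eq0; apply/eqP/tri_class_iso/(@concentrated_iso _ 0).
- exact: single_concentrated.
- by move=> i im; apply: is_zero_bip; exact: single_concentrated.
- by rewrite /=; exact: isomorphic_refl.
Qed.

(** Induction on the length of an interval of degrees containing the complex:
    the lowest term is split off by a brutal truncation, and a complex
    concentrated in one degree has, up to sign, the class of its term placed in
    degree 0. *)
Lemma tri_class_generated (A : addCat) (P : K_tri (Kb A) -> Prop) :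
  P 0 -> (forall x y, P x -> P y -> P (x - y)) ->
  (forall B : A, P (tri_class (single 0 B))) -> forall X, P (tri_class X).
Proof.
move=> P0 PB Ps.
have PN x : P x -> P (- x) by rewrite -[- x]sub0r; exact: PB.
have PD x y : P x -> P y -> P (x + y).
  by move=> Px Py; rewrite -[y]opprK; apply: PB => //; exact: PN.
have Pconc m X : concentrated m X -> P (tri_class X).
  move=> /tri_class_concentrated->; rewrite tri_class_single /alt.
  by case: ifP => _; [apply/PN/Ps | exact: Ps].
have Pseg n : forall (m : int) (X : bcomplex A),
    (forall i, ~~ (m <= i < m + n%:Z) -> is_zero (X i)) -> P (tri_class X).
  elim: n => [|n IHn] m X X0; first by apply: (Pconc m) => i _; apply: X0; lia.
  pose above (i : int) := m + 1 <= i.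
  rewrite (@tri_class_trunc _ above) => [|i]; last by rewrite /above; lia.
  apply: PD.
    apply: (IHn (m + 1)) => i mi; apply: cut_zero => ai; apply: X0.
    by move: ai mi; rewrite /above; lia.
  apply: (Pconc m) => i im; apply: cut_zero => ai; apply: X0.
  by move: ai im; rewrite /= /above; lia.
move=> X; have [s sP] := bounded X.
pose N := (\max_(i <- s) `|i|)%N.
apply: (Pseg (N + N).+1 (- N%:Z)) => i iN; apply: sP; apply: contra iN => si.
have : (`|i| <= N)%N by apply: leq_bigmax_seq.
lia.
Qed.

Theorem theorem1p1 (A : addCat) :
  exists phi : {additive K_split A -> K_tri (Kb A)}, bijective phi.
Proof.
have [phi phiE] := tri_lift A; have [psi psiE] := euler_lift A.
have phiK : cancel phi psi.
  apply: presented_ind => [|x y Px Py|t]; first by rewrite !raddf0.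
    by rewrite !raddfB Px Py.
  rewrite -[t]reprK -[generator _ _]/(split_class (repr t : A)).
  by rewrite phiE psiE euler_single.
have phi_surj : forall y, exists x, phi x = y.
  apply: presented_ind => [|y z [x <-] [x' <-]|t].
  - by exists 0; rewrite raddf0.
  - by exists (x - x'); rewrite raddfB.
  rewrite -[t]reprK.
  apply: (tri_class_generated (P := fun y => exists x, phi x = y)).
  - by exists 0; rewrite raddf0.
  - by move=> y z [x <-] [x' <-]; exists (x - x'); rewrite raddfB.
  - by move=> B; exists (split_class B).
by exists phi, psi => // y; have [x <-] := phi_surj y; rewrite phiK.
Qed.
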